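(* Let $\mu$ be a Borel probability measure on $\mathbb{R}^d$ and let $\alpha>0$. Fix a family $(u_\varepsilon)_{\varepsilon>0}$ of real numbers with $\varepsilon\le u_\varepsilon$ and $\lim_{\varepsilon\to 0}u_\varepsilon=0$, and let $T_\mu(\alpha)$ be the associated quantity (defined in the context). Assume that $s:=\inf_{q\in\mathbb{R}}B_\mu(q)<0$. Then $$\mathrm{Dim}(\overline{X}^{\alpha})\le \frac{1}{\alpha}\,T_\mu(\alpha)\,\inf_{q\ge 1}\bigl(\alpha q+B_\mu(q)\bigr).$$
   Context: **Multifractal packing dimensions.** $B(x,r)$ denotes the closed ball. A centered $\varepsilon$-packing of $E\subset\mathbb{R}^d$ is a countable family $(B(x_i,r_i))_{i\in I}$ of pairwise disjoint balls with $x_i\in E$ and $0<r_i<\varepsilon$. With the conventions $0^q=+\infty$ for $q<0$ and $0^0=1$, put for $q,t\in\mathbb{R}$ $$\overline{P}^{q,t}_{\mu,\varepsilon}(E)=\sup\Bigl\{\sum_i\mu(B(x_i,r_i))^q(2r_i)^t\Bigr\},$$ the supremum being over all centered $\varepsilon$-packings of $E$, and $$\overline{P}^{q,t}_\mu(E)=\lim_{\varepsilon\to0}\overline{P}^{q,t}_{\mu,\varepsilon}(E),\qquad P^{q,t}_\mu(E)=\inf_{E\subset\bigcup_iE_i}\sum_i\overline{P}^{q,t}_\mu(E_i)$$ (infimum over countable covers). $\mathrm{Dim}^q_\mu(E)$ is the critical value such that $P^{q,t}_\mu(E)=\infty$ for $t<\mathrm{Dim}^q_\mu(E)$ and $P^{q,t}_\mu(E)=0$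 for $t>\mathrm{Dim}^q_\mu(E)$. Put $B_\mu(q)=\mathrm{Dim}^q_\mu(\mathrm{supp}\,\mu)$. $\mathrm{Dim}(E)=\mathrm{Dim}^0_\mu(E)$ is the usual packing dimension. **Level sets.** $$\overline{X}^\alpha=\Bigl\{x\in\mathrm{supp}\,\mu:\limsup_{r\to0}\frac{\log\mu(B(x,r))}{\log r}\le\alpha\Bigr\}.$$ For $\eta>\alpha$ and an integer $p\ge1$, $$X_\alpha(\eta,p)=\Bigl\{x\in\overline{X}^\alpha:\text{ for every } r>0,\ 2r\ge\tfrac1p\ \text{ or }\ (2r)^\eta\le\mu(B(x,r))\Bigr\}.$$ **The quantities $L$ and $T_\mu$.** Let $k\ge1$ be an integer and $M\subset\mathrm{supp}\,\mu$. For a centered $\varepsilon$-packing $(B(x_i,r_i))_{i\in I}$ of $M$, say that a family of balls $(B(y_i,\delta_i))_{i\in I}$ with the same index set satisfies $(\mathcal P_k)$ if there is a finite partition $I=I_1\cup\dots\cup I_m$ with $1\le m\le k$ such that, for each $1\le j\le m$, $(B(y_i,\delta_i))_{i\in I_j}$ is a centered $u_\varepsilon$-packing of $M$. Put $$L^k_{\varepsilon,(B(x_i,r_i))_{i\in I}}(M)=\inf\Bigl(\sup_{i\in I}\frac{\log\mu(B(y_i,\delta_i))}{\log 2r_i}\Bigr),$$ the infimum being over all families satisfying $(\mathcal P_k)$; $L^k_\varepsilon(M)=\sup L^k_{\varepsilon,(B(x_i,r_i))_{i\in I}}(M)$, the supremum being over all centered $\varepsilon$-packings of $M$; $L^k(M)=\lim_{\varepsilon\to0}L^k_\varepsilon(M)$;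 $L(M)=\lim_{k\to+\infty}L^k(M)$. Finally $$T_\mu(\alpha,\eta,p)=\sup_{M\subset X_\alpha(\eta,p)}L(M),\quad T_\mu(\alpha,\eta)=\lim_{p\to+\infty}T_\mu(\alpha,\eta,p),\quad T_\mu(\alpha)=\lim_{\eta\to\alpha^+}T_\mu(\alpha,\eta).$$ *)

(* Defs.v *)
From HB Require Import structures.
From mathcomp Require Import all_boot all_order all_algebra.
From mathcomp Require Import all_classical all_reals all_analysis.

Set Implicit Arguments.
Unset Strict Implicit.
Unset Printing Implicit Defensive.

Import Order.TTheory GRing.Theory Num.Theory.
Import numFieldNormedType.Exports.

Local Open Scope classical_set_scope.
Local Open Scope ring_scope.

Notation borelRd R d := (g_sigma_algebraType (@open 'rV[R]_d)).

Section Balls.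
Context (R : realType) (d : nat).
Implicit Types (x y : 'rV[R]_d) (r : R).

(* The norm MathComp-Analysis puts on 'rV[R]_d is the sup norm (with the same
   open sets), hence the explicit Euclidean distance. *)
Definition edist x y : R := Num.sqrt (\sum_(i < d) (x 0 i - y 0 i) ^+ 2).

Definition eball x r : set 'rV[R]_d := [set y | edist x y <= r].

(* An at most countable family of balls is encoded by sequences of centers and
   radii restricted to an index set I of natural numbers. *)
Definition packing (eps : R) (E : set 'rV[R]_d) (I : set nat)
    (x : nat -> 'rV[R]_d) (r : nat -> R) : Prop :=
  (forall i, I i -> E (x i) /\ 0 < r i < eps) /\
  trivIset I (fun i => eball (x i) (r i)).

End Balls.

(* Unlike powR, sends 0 to +oo when q < 0; it sends 0 to 1 when q = 0. *)
Definition mpow (R : realType) (m q : R) : \bar R :=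
  if (m == 0) && (q < 0) then +oo%E else (m `^ q)%:E.

Section Multifractal.
Context (R : realType) (d : nat) (mu : probability (borelRd R d) R).
Implicit Types (E M : set 'rV[R]_d) (q t eps alpha eta : R) (k p : nat).

Definition supp : set 'rV[R]_d :=
  [set x | forall U : set 'rV[R]_d, open U -> U x -> (0 < mu U)%E].

Definition mball (x : 'rV[R]_d) (r : R) : R := fine (mu (eball x r)).

Definition packing_sum q t (I : set nat) (x : nat -> 'rV[R]_d)
    (r : nat -> R) : \bar R :=
  (\esum_(i in I) (mpow (mball (x i) (r i)) q * ((2 * r i) `^ t)%:E))%E.

Definition Pbar_eps q t eps E : \bar R :=
  ereal_sup [set a | exists I x r, packing eps E I x r /\
                                   a = packing_sum q t I x r].

Definition Pbar q t E : \bar R := lim (Pbar_eps q t eps E @[eps --> 0^'+]).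

Definition Pmu q t E : \bar R :=
  ereal_inf [set (\sum_(0 <= i <oo) Pbar q t (F i))%E |
             F in [set F : nat -> set 'rV[R]_d | E `<=` \bigcup_i F i]].

(* The critical value of t |-> Pmu q t E, see Dimq_critical. *)
Definition Dimq q E : \bar R :=
  ereal_inf [set t%:E | t in [set t | Pmu q t E = 0%E]].

Lemma mpow_ge0 (m q : R) : (0 <= mpow m q)%E.
Proof. by rewrite /mpow; case: ifP => _ //; rewrite lee_fin powR_ge0. Qed.

Lemma term_ge0 q t (m r : R) : (0 <= mpow m q * ((2 * r) `^ t)%:E)%E.
Proof. by rewrite mule_ge0 ?mpow_ge0 ?lee_fin ?powR_ge0. Qed.

Lemma packing_le eps eps' E I x (r : nat -> R) : eps <= eps' ->
  packing eps E I x r -> packing eps' E I x r.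
Proof.
move=> ee' [H ?]; split => // i /H[? /andP[r0 re]]; split => //.
by rewrite r0 (lt_le_trans re).
Qed.

Lemma Pbar_eps_ge0 q t eps E : (0 <= Pbar_eps q t eps E)%E.
Proof.
apply: ereal_sup_ubound; exists set0, (fun=> 0), (fun=> 0).
split; last by rewrite /packing_sum esum_set0.
by split => // i j [].
Qed.

Lemma Pbar_eps_le q t eps eps' E : eps <= eps' ->
  (Pbar_eps q t eps E <= Pbar_eps q t eps' E)%E.
Proof.
move=> ee'; apply: ge_ereal_sup => _ [I [x [r [H ->]]]].
by apply: ereal_sup_ubound; exists I, x, r; split => //; exact: packing_le H.
Qed.

Lemma Pbar_eps_exponent q t t' eps E : t < t' -> 0 < eps ->
  (Pbar_eps q t' eps E <=
   ((2 * eps) `^ (t' - t))%:E * Pbar_eps q t eps E)%E.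
Proof.
move=> tt' e0; apply: ge_ereal_sup => _ [I [x [r [H ->]]]].
apply: (@le_trans _ _ (((2 * eps) `^ (t' - t))%:E * packing_sum q t I x r)%E);
  last first.
  by rewrite lee_wpmul2l ?lee_fin ?powR_ge0//; apply: ereal_sup_ubound; exists I, x, r.
apply: ge_ereal_sup => _ [F [Ffin FI] <-].
apply: (@le_trans _ _ (((2 * eps) `^ (t' - t))%:E * \sum_(i \in F)
    (mpow (mball (x i) (r i)) q * ((2 * r i) `^ t)%:E))%E); last first.
  rewrite lee_wpmul2l ?lee_fin ?powR_ge0//; apply: ereal_sup_ubound.
  by exists F.
rewrite ge0_mule_fsumr; last by move=> i; exact: term_ge0.
apply: lee_fsum => // i Fi.
have [_ /andP[r0 re]] := H.1 i (FI _ Fi).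
rewrite muleCA lee_wpmul2l ?mpow_ge0// -EFinM lee_fin.
have -> : t' = (t' - t) + t by rewrite subrK.
rewrite powRD; last by rewrite (_ : 2 * r i != 0) ?implybT// gt_eqF// mulr_gt0.
rewrite addrK ler_wpM2r ?powR_ge0// ge0_ler_powR ?nnegrE ?subr_ge0 ?(ltW tt')//.
- by rewrite mulr_ge0// ltW.
- by rewrite mulr_ge0// ltW.
- by rewrite ler_wpM2l// ltW.
Qed.

Lemma Pbar_cvg q t E :
  Pbar_eps q t eps E @[eps --> 0^'+] --> Pbar q t E.
Proof.
apply: nondecreasing_at_right_is_cvge.
by near=> e => a b _ _ ab; exact: Pbar_eps_le.
Unshelve. all: by end_near. Qed.

Lemma Pbar_ge0 q t E : (0 <= Pbar q t E)%E.
Proof.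
by apply: lime_ge; [apply/cvg_ex; exists (Pbar q t E); exact: Pbar_cvg|near=> e; exact: Pbar_eps_ge0].
Unshelve. all: by end_near. Qed.

Lemma Pbar_exponent q t t' E : t < t' -> (Pbar q t E < +oo)%E ->
  Pbar q t' E = 0%E.
Proof.
move=> tt' fin; apply: cvg_lim => //.
have [e /= e0 ePoo] : exists2 e, 0 < e & (Pbar_eps q t e E < +oo)%E.
  have : \forall e \near 0^'+, (Pbar_eps q t e E < +oo)%E.
    apply: (@Pbar_cvg q t E [set y | (y < +oo)%E]).
    exact: open_ereal_lt'.
  move=> H; near (0:R)^'+ => e; exists e; first by [].
  by near: e.
have Pfin : Pbar_eps q t e E \is a fin_num by rewrite ge0_fin_numE ?Pbar_eps_ge0.
set K := fine (Pbar_eps q t e E).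
apply: (@squeeze_cvge _ _ _ _ (fun=> 0%E) _
  (fun a => (a `^ (t' - t) * (2 `^ (t' - t) * K))%:E)).
- near=> a; rewrite Pbar_eps_ge0 /= (le_trans (Pbar_eps_exponent _ _ tt' _))//.
  rewrite mulrA [X in (X * K)%:E]mulrC -powRM// EFinM.
  rewrite lee_wpmul2l ?lee_fin ?powR_ge0// /K fineK// Pbar_eps_le//.
  by near: a; exact: nbhs_right_le.
- exact: cvg_cst.
- apply: cvg_EFin; first by near=> a.
  rewrite -[X in _ --> X](mul0r (2 `^ (t' - t) * K)).
  by apply: cvgMr_tmp; apply: powR_cvg0; rewrite subr_gt0.
Unshelve. all: by end_near. Qed.

Lemma Pmu_exponent q t t' E : t < t' -> (Pmu q t E < +oo)%E ->
  Pmu q t' E = 0%E.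
Proof.
move=> tt' /ereal_inf_lt[_ [F EF <-] Foo].
apply/eqP; rewrite eq_le; apply/andP; split; last first.
  apply: le_ereal_inf_tmp => _ [G _ <-].
  by apply: nneseries_ge0 => i _ _; exact: Pbar_ge0.
apply: ereal_inf_lbound; exists F => //.
apply: eseries0 => i _ _; apply: (Pbar_exponent tt').
apply: le_lt_trans Foo; rewrite (@nneseriesD1 _ _ i)//; last by move=> k _; exact: Pbar_ge0.
by rewrite leeDl// nneseries_ge0// => k _ _; exact: Pbar_ge0.
Qed.

Lemma Dimq_critical q E :
  (forall t, (t%:E < Dimq q E)%E -> Pmu q t E = +oo%E) /\
  (forall t, (Dimq q E < t%:E)%E -> Pmu q t E = 0%E).
Proof.
split=> t.
- move=> tD; apply/eqP; rewrite -leye_eq leNgt; apply/negP => Poo.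
  have [s /andP[ts sD]] : exists s : R, (t%:E < s%:E < Dimq q E)%E.
    case D : (Dimq q E) tD => [D0| |] // => [|_].
      rewrite lte_fin => tD; exists ((t + D0) / 2).
      by rewrite !lte_fin !midf_lt.
    by exists (t + 1); rewrite lte_fin ltrDl ltr01 ltry.
  have : (Dimq q E <= s%:E)%E.
    by apply: ereal_inf_lbound; exists s => //; apply: Pmu_exponent Poo.
  by rewrite leNgt sD.
- move=> /ereal_inf_lt[_ [s Ps0 <-]]; rewrite lte_fin => st.
  by apply: (Pmu_exponent st); rewrite Ps0.
Qed.

Definition Bmu q : \bar R := Dimq q supp.

Definition Dim E : \bar R := Dimq 0 E.

Definition Xbar alpha : set 'rV[R]_d :=
  [set x | supp x /\
     (limf_esup (fun r : R => (ln (mball x r) / ln r)%:E) (0^'+) <= alpha%:E)%E].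

Definition Xlevel alpha eta p : set 'rV[R]_d :=
  [set x | Xbar alpha x /\ forall r : R, 0 < r ->
     p%:R^-1 <= 2 * r \/ (2 * r) `^ eta <= mball x r].

(* The map c sends an index to the number of its part. *)
Definition Pk k (e : R) M (I : set nat) (y : nat -> 'rV[R]_d)
    (delta : nat -> R) : Prop :=
  exists (m : nat) (c : nat -> nat), (1 <= m <= k)%N /\
    (forall i, I i -> (c i < m)%N) /\
    (forall j, (j < m)%N -> packing e M (I `&` [set i | c i = j]) y delta).

Section Tmu.
Context (u : R -> R).

Definition Lk_packing k eps M (I : set nat) (r : nat -> R) : \bar R :=
  ereal_inf [set a | exists y delta, Pk k (u eps) M I y delta /\
    a = ereal_sup [set (ln (mball (y i) (delta i)) / ln (2 * r i))%:E | i in I]].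

Definition Lk_eps k eps M : \bar R :=
  ereal_sup [set a | exists I x r, packing eps M I x r /\
                                   a = Lk_packing k eps M I r].

(* The function eps |-> Lk_eps k eps M is not monotone and need not converge
   (for M = [set x] it is ln (mball x (u eps)) / ln (2 * eps), up to boundary
   effects).  The limit at 0 is read as the lower limit: it agrees with the
   limit whenever that exists, and yields the smallest Tmu, hence the strongest
   upper bound. *)
Definition Lk k M : \bar R := limf_einf (fun eps => Lk_eps k eps M) (0^'+).

Definition L M : \bar R := limn (fun k => Lk k M).

Definition Tmu_p alpha eta p : \bar R :=
  ereal_sup [set L M | M in [set M | M `<=` Xlevel alpha eta p]].

Definition Tmu_eta alpha eta : \bar R := limn (fun p => Tmu_p alpha eta p).

Definition Tmu alpha : \bar R := lim (Tmu_eta alpha eta @[eta --> alpha^'+]).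

End Tmu.

End Multifractal.

(* Main.v *)
Require Import Defs.
From mathcomp Require Import all_boot all_order all_algebra ring.
From mathcomp Require Import all_classical all_reals all_analysis.
Import Order.TTheory GRing.Theory Num.Theory.
Import numFieldNormedType.Exports.
Local Open Scope classical_set_scope.
Local Open Scope ring_scope.
Set Implicit Arguments.
Unset Strict Implicit.

(* Let M be a subset of Xlevel mu alpha eta p on which the packing premeasure of
   exponents (q, tau), tau <= 0, is finite.  If L M < l, the balls of a fine
   packing of M, of radii r, are matched with balls B(y, s) forming boundedly many
   packings of M and such that (2 r)^l <= mu (B(y, s)).  As
   (2 s)^eta <= mu (B(y, s)),
     (2 r)^(l (q + tau / eta)) <= mu (B(y, s))^(q + tau / eta)
                               <= mu (B(y, s))^q (2 s)^tau,
   so the packing dimension of M is at most l (q + tau / eta).  When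
   alpha q + Bmu q < alpha with 1 <= q, one takes tau > Bmu q close to Bmu q, hence
   tau < 0; otherwise q = 1, tau = 0 works, the balls of a packing being disjoint.
   This avoids the convexity of Bmu.  A negative infimum forces Xbar to be empty. *)

(** * Euclidean balls: measurability and mass *)

Section Balls.
Context (R : realType) (d : nat) (mu : probability (borelRd R d) R).
Implicit Types (x y : 'rV[R]_d) (r : R).

(** The topology on ['rV[R]_d] comes from the sup norm; continuity of the Euclidean distance for it
    makes [eball] closed, hence Borel. *)
Lemma edist_continuous x : continuous (Defs.edist x).
Proof.
move=> y; apply: continuous_comp; last exact: sqrt_continuous.
apply: (@continuous_big _ _ (fun a b : R^o => a + b) 0 xpredT _ _ _
  (fun i (y : 'rV[R]_d) => (x 0 i - y 0 i) ^+ 2)) => [|i _ z].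
  exact: add_continuous.
rewrite /=.
apply: (@continuous_comp _ _ _ (fun y : 'rV[R]_d => x 0 i - y 0 i : R^o)
  (fun s : R^o => s ^+ 2)); last exact: exprn_continuous.
by apply: (@continuousB R R^o _ (cst (x 0 i)) (fun y : 'rV[R]_d => y 0 i));
  [exact: cst_continuous|exact: coord_continuous].
Qed.

Lemma measurable_eball x r : measurable (eball x r : set (borelRd R d)).
Proof.
rewrite -[eball x r]setCK; apply: measurableC; apply: sub_sigma_algebra.
apply: closed_openC.
have /continuous_closedP := @edist_continuous x.
by move=> /(_ _ (@closed_le _ r)).
Qed.

Lemma mballE x r : (mball mu x r)%:E = mu (eball x r).
Proof. by rewrite fineK// fin_num_measure//; exact: measurable_eball. Qed.

Lemma mball_le1 x r : mball mu x r <= 1.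
Proof. by rewrite -lee_fin mballE probability_le1//; exact: measurable_eball. Qed.

Lemma mball_ge0 x r : 0 <= mball mu x r.
Proof. by rewrite -lee_fin mballE. Qed.

(** [supp] tests open sets only, so positivity is obtained on the open ball contained in [eball]. *)
Lemma mball_gt0 x r : supp mu x -> 0 < r -> 0 < mball mu x r.
Proof.
move=> sx r0; pose U : set 'rV[R]_d := Defs.edist x @^-1` [set s | s < r].
have oU : open U.
  by have /continuousP := @edist_continuous x; apply; exact: open_lt.
rewrite -lte_fin mballE; apply: (@lt_le_trans _ _ (mu U)).
  apply: sx => //; rewrite /U /= /Defs.edist big1 ?sqrtr0// => i _.
  by rewrite subrr expr0n.
apply: le_measure; rewrite ?inE.
- exact: sub_sigma_algebra.
- exact: measurable_eball.
- by move=> y /ltW.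
Qed.

End Balls.

(** * Real powers and quotients of logarithms *)

Section PowerInequalities.
Context (R : realType).
Implicit Types (a b l m s x y : R).

Lemma le0_ler_powR a x y : a <= 0 -> 0 < x -> x <= y -> y `^ a <= x `^ a.
Proof.
move=> a0 x0 xy; rewrite -[a]opprK !(powRN _ (- a)).
have y0 := lt_le_trans x0 xy.
rewrite lef_pV2 ?posrE ?powR_gt0// ge0_ler_powR ?oppr_ge0// nnegrE ltW//.
Qed.

(** Since ln s < 0, multiplying by it flips the inequality. This turns the quotients in [Lk_packing]
    and [Xbar] into power bounds on masses. *)
Lemma ln_ratio_le s m l : 0 < s < 1 -> 0 < m ->
  (ln m / ln s <= l) = (s `^ l <= m).
Proof.
move=> /andP[s0 s1] m0.
by rewrite ler_ndivrMr ?ln_lt0 ?s0// -ln_powR ler_ln ?posrE ?powR_gt0.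
Qed.

Lemma ln_ratio_ge0 s m : 0 < s < 1 -> 0 < m <= 1 -> 0 <= ln m / ln s.
Proof.
move=> /andP[s0 s1] /andP[m0 m1].
by rewrite mulr_le0// ?invr_le0 ?ln_le0// ltW.
Qed.

Lemma at_right0P (P : set R) : (0^'+)%classic P ->
  exists2 e, 0 < e & forall r, 0 < r < e -> P r.
Proof.
move=> [e /= e0 He]; exists e => // r /andP[r0 re].
by apply: He => //=; rewrite sub0r normrN gtr0_norm.
Qed.

End PowerInequalities.

(** * Lower limits along a filter *)

Section LowerLimit.
Context (R : realType).
Implicit Types (f g : R -> \bar R) (c : \bar R) (F : set_system R).

Lemma limf_einf_le f g F : (forall e, f e <= g e)%E ->
  (limf_einf f F <= limf_einf g F)%E.
Proof.
move=> fg; rewrite !limf_einfE; apply: ge_ereal_sup => _ [V FV <-].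
apply: le_trans (ereal_sup_ubound _); last by exists V.
apply: le_ereal_inf_tmp => _ [e Ve <-]; apply: le_trans (fg e).
by apply: ereal_inf_lbound; exists e.
Qed.

(** A bound on the lower limit yields one good scale in each set of the filter, not all small
    scales. One is enough later, because [Pbar] is bounded by [Pbar_eps] at any positive scale. *)
Lemma limf_einf_lt_frequently f F c V : (limf_einf f F < c)%E -> F V ->
  exists2 e, V e & (f e < c)%E.
Proof.
move=> fc FV; suff /ereal_inf_lt[_ [e Ve <-] ?] : (ereal_inf (f @` V) < c)%E.
  by exists e.
by apply: le_lt_trans fc; rewrite limf_einfE; apply: ereal_sup_ubound; exists V.
Qed.

Lemma limf_einf_ge_near f F c : (\forall e \near F, c <= f e)%E ->
  (c <= limf_einf f F)%E.
Proof.
move=> Fc; rewrite limf_einfE.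
apply: le_trans (ereal_sup_ubound _); last by eexists; [exact: Fc|].
by apply: le_ereal_inf_tmp => _ [e /= ce <-].
Qed.

Lemma limf_einf_le_near f F {PF : ProperFilter F} c :
  (\forall e \near F, f e <= c)%E -> (limf_einf f F <= c)%E.
Proof.
move=> Fc; rewrite leNgt; apply/negP => cf.
move: cf; rewrite limf_einfE => /ereal_sup_gt[_ [V FV <-]].
have [e [Ve fe]] := filter_ex (filterI FV Fc).
by apply/negP; rewrite -leNgt (le_trans _ fe)//; apply: ereal_inf_lbound; exists e.
Qed.

End LowerLimit.

(** * Monotonicity and bounds for packing premeasures *)

Section PackingSums.
Context (R : realType) (d : nat) (mu : probability (borelRd R d) R).
Implicit Types (M N : set 'rV[R]_d) (q t e : R).

Lemma packing_sub e M N I (x : nat -> 'rV[R]_d) (r : nat -> R) : M `<=` N ->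
  packing e M I x r -> packing e N I x r.
Proof. by move=> MN [H ?]; split=> // i /H[/MN]. Qed.

Lemma packing_single e M x : 0 < e -> M x ->
  packing e M [set 0%N] (fun=> x) (fun=> e / 2).
Proof.
move=> e0 Mx; split=> [i _|i j -> ->//].
by rewrite divr_gt0// ltr_pdivrMr// ltr_pMr// ltr1n.
Qed.

Lemma Pbar_eps_sub q t e M N : M `<=` N ->
  (Pbar_eps mu q t e M <= Pbar_eps mu q t e N)%E.
Proof.
move=> MN; apply: ge_ereal_sup => _ [I [x [r [H ->]]]].
by apply: ereal_sup_ubound; exists I, x, r; split => //; exact: packing_sub H.
Qed.

Lemma Pbar_le_Pbar_eps q t e M : 0 < e ->
  (Pbar mu q t M <= Pbar_eps mu q t e M)%E.
Proof.
move=> e0; apply: lime_le; first by apply: cvgP; exact: Pbar_cvg.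
by near=> a; apply: Pbar_eps_le; near: a; exact: nbhs_right_ltW.
Unshelve. all: by end_near. Qed.

Lemma Pbar_sub q t M N : M `<=` N -> (Pbar mu q t M <= Pbar mu q t N)%E.
Proof.
move=> MN; apply: lee_lim; [by apply: cvgP; exact: Pbar_cvg..|].
by near=> a; exact: Pbar_eps_sub.
Unshelve. all: by end_near. Qed.

Lemma Pbar_lt_Pbar_eps q t M : (Pbar mu q t M < +oo)%E ->
  exists2 e, 0 < e & (Pbar_eps mu q t e M < +oo)%E.
Proof.
move=> fin.
have : \forall e \near 0^'+, (Pbar_eps mu q t e M < +oo)%E.
  apply: (@Pbar_cvg _ _ mu q t M [set y | (y < +oo)%E]).
  exact: open_ereal_lt'.
move=> H; near (0:R)^'+ => e; exists e; first by [].
by near: e.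
Unshelve. all: by end_near. Qed.

(** Sorting the indices by part splits the sum into sums over packings of [M], each bounded by
    [Pbar_eps]. *)
Lemma packing_sum_parts q t e M k I c (y : nat -> 'rV[R]_d) (r : nat -> R) :
  (forall i, I i -> (c i < k)%N) ->
  (forall j, (j < k)%N -> packing e M (I `&` [set i | c i = j]) y r) ->
  (packing_sum mu q t I y r <= \sum_(j < k) Pbar_eps mu q t e M)%E.
Proof.
move=> cI pI; rewrite /packing_sum.
set f := fun i => _.
have f0 i : (0 <= f i)%E by exact: term_ge0.
rewrite (eq_esum (b := fun i => (\sum_(j < k)
    if i \in [set i | c i = j] then f i else 0)%E)); last first.
  move=> i Ii; rewrite (bigD1 (Ordinal (cI i Ii)))//= mem_set//.
  rewrite big1 ?adde0// => j jc; rewrite memNset//= => cj.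
  by move/eqP: jc; apply; apply: val_inj.
rewrite esum_sum; last by move=> i j _ _; case: ifP.
apply: lee_sum => j _; rewrite -esum_mkcondr.
apply: ereal_sup_ubound; exists (I `&` [set i | c i = j]), y, r.
by split => //; exact: pI.
Qed.

(** The balls are disjoint, so their masses add up to at most the total mass. *)
Lemma Pbar_eps_1_0 e M : (Pbar_eps mu 1 0 e M <= 1)%E.
Proof.
apply: ge_ereal_sup => _ [I [x [r [[_ tI] ->]]]].
apply: ge_ereal_sup => _ [F [Ffin FI] <-].
rewrite (eq_fsbigr (fun i => mu (eball (x i) (r i)))); last first.
  move=> i _; rewrite /mpow ltNge ler01 andbF powRr0 mule1 powRr1 ?mballE//.
  exact: mball_ge0.
rewrite -(measure_fin_bigcup mu)//.
- apply: probability_le1; apply: fin_bigcup_measurable => // i _.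
  exact: measurable_eball.
- exact: sub_trivIset tI.
- by move=> i _; exact: measurable_eball.
Qed.

End PackingSums.

(** * From exponents (q, tau) to an ordinary packing exponent *)

Section ChangeOfExponent.
Context (R : realType) (d : nat) (mu : probability (borelRd R d) R).
Context (u : R -> R).
Implicit Types (M N : set 'rV[R]_d) (q tau eta l : R).

(** Allowing more parts admits more matched families and lowers the infimum; hence the limit over
    [k] defining [L] exists. *)
Lemma Lk_nonincreasing M :
  {homo (fun k => Lk mu u k M) : n m / (n <= m)%N >-> (m <= n)%E}.
Proof.
move=> k k' kk'; apply: limf_einf_le => e; apply: ge_ereal_sup => _ [I [x [r [H ->]]]].
apply: (@le_trans _ _ (Lk_packing mu u k e M I r)); last first.
  by apply: ereal_sup_ubound; exists I, x, r.
apply: le_ereal_inf_tmp => _ [y [s [[m [c [/andP[m1 mk] Hc]]] ->]]].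
apply: ereal_inf_lbound; exists y, s; split => //.
by exists m, c; split => //; rewrite m1 (leq_trans mk).
Qed.

Lemma L_lt M l : (L mu u M < l%:E)%E -> exists k, (Lk mu u k M < l%:E)%E.
Proof.
move=> Ll; apply/not_existsP => H; move: Ll; apply/negP; rewrite -leNgt.
apply: lime_ge; first exact: ereal_nonincreasing_is_cvgn (@Lk_nonincreasing M).
by near=> k; rewrite leNgt; apply/negP; exact: H.
Unshelve. all: by end_near. Qed.

Hypothesis hu0 : u eps @[eps --> 0^'+] --> (0 : R).

Lemma Pbar_change_exponent q tau eta l alpha p M :
  tau <= 0 -> 0 < eta -> 0 <= q + tau / eta ->
  M `<=` Xlevel mu alpha eta p.+1 -> (Pbar mu q tau M < +oo)%E ->
  (L mu u M < l%:E)%E -> (Pbar mu 0 (l * (q + tau / eta)) M < +oo)%E.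
Proof.
move=> tau0 eta0 k0 MX /Pbar_lt_Pbar_eps[e0 e0_gt0 Pe0] /L_lt[k Lkl].
(* [e < 2^-1] gives 2 r < 1, so ln (2 r) < 0; the bounds on [u e] put the matched balls at scale
   [e0] and below the threshold 1/(p+1) of [Xlevel]. *)
have H : \forall e \near 0^'+,
    [/\ 0 < e :> R, e < 2^-1, u e < e0 & 2 * u e < p.+1%:R^-1].
  near=> e; split; first by [].
  - by near: e; apply: nbhs_right_lt; rewrite invr_gt0.
  - by near: e; exact: (cvgr_lt _ hu0).
  - rewrite -ltr_pdivlMl//; near: e; apply: (cvgr_lt _ hu0).
    by rewrite mulr_gt0 ?invr_gt0.
have [e [e_gt0 e_half ue uep] Lel] := limf_einf_lt_frequently Lkl H.
apply: (@le_lt_trans _ _ (\sum_(j < k) Pbar_eps mu q tau e0 M)%E); last first.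
  exact: lte_sum_pinfty.
apply: (le_trans (Pbar_le_Pbar_eps _ _ _ _ e_gt0)).
apply: ge_ereal_sup => _ [I [x [r [Mxr ->]]]].
have : (Lk_packing mu u k e M I r < l%:E)%E.
  by apply: le_lt_trans Lel; apply: ereal_sup_ubound; exists I, x, r.
move=> /ereal_inf_lt[_ [y [s [[m [c [/andP[m1 mk] [cm Mys]]] ->]]]]] ysl.
apply: (@le_trans _ _ (packing_sum mu q tau I y s)); last first.
  apply: (@packing_sum_parts _ _ _ _ _ _ _ _ _ c) => [i /cm im|j jk].
    exact: leq_trans mk.
  (* Only [m <= k] parts exist; those numbered from [m] on are empty, hence vacuously packings. *)
  have [jm|mj] := ltnP j m; first exact: packing_le (ltW ue) (Mys _ jm).
  split=> [i [Ii /= cij]|i i' [Ii /= cij]];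
    by have := leq_trans (cm i Ii) mj; rewrite cij ltnn.
apply: le_esum => i Ii.
have [_ /andP[ri0 rie]] := Mxr.1 i Ii.
have [My /andP[si0 sie]] := (Mys _ (cm i Ii)).1 i (conj Ii erefl).
have [[suppy _] Xy] := MX _ My.
set b := mball mu (y i) (s i).
have b0 : 0 < b by exact: mball_gt0.
have sb : (2 * s i) `^ eta <= b.
  have [ps|//] := Xy _ si0; exfalso.
  have := le_lt_trans ps (lt_trans (_ : 2 * s i < 2 * u e) uep).
  by rewrite ltr_pM2l// ltxx => /(_ sie).
have rb : (2 * r i) `^ l <= b.
  rewrite -ln_ratio_le//; last first.
    rewrite mulr_gt0//= -ltr_pdivlMl// mulr1.
    exact: lt_trans e_half.
  rewrite -lee_fin (le_trans _ (ltW ysl))//.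
  by apply: ereal_sup_ubound; exists i.
rewrite /mpow ltxx andbF powRr0 mul1e (gt_eqF b0)/= -EFinM lee_fin.
rewrite powRrM; apply: (@le_trans _ _ (b `^ (q + tau / eta))).
  by rewrite ge0_ler_powR// ?nnegrE ?powR_ge0// ltW.
rewrite powRD ?(gt_eqF b0) ?implybT// ler_wpM2l ?powR_ge0//.
(* As tau / eta <= 0, raising [sb] to this power reverses it. *)
have -> : (2 * s i) `^ tau = ((2 * s i) `^ eta) `^ (tau / eta).
  by rewrite -powRrM mulrCA divff ?mulr1// gt_eqF.
apply: le0_ler_powR => //; last by rewrite powR_gt0// mulr_gt0.
by rewrite mulr_le0_ge0// invr_ge0 ltW.
Unshelve. all: by end_near. Qed.

End ChangeOfExponent.

(** * Level sets and the range of [Tmu] *)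

Section LevelSets.
Context (R : realType) (d : nat) (mu : probability (borelRd R d) R).
Context (u : R -> R) (alpha : R).
Implicit Types (M N : set 'rV[R]_d) (q tau eta l : R).

Lemma Xlevel_le_p eta p p' : (p <= p')%N ->
  Xlevel mu alpha eta p.+1 `<=` Xlevel mu alpha eta p'.+1.
Proof.
move=> pp' x [Xx H]; split=> // r /H[pr|]; [left|by right].
by apply: le_trans pr; rewrite lef_pV2 ?posrE// ler_nat.
Qed.

(** Below the threshold, 2 r < 1/(p+1) <= 1, so a larger exponent gives a smaller power. *)
Lemma Xlevel_le_eta eta eta' p : eta <= eta' ->
  Xlevel mu alpha eta p.+1 `<=` Xlevel mu alpha eta' p.+1.
Proof.
move=> ee' x [Xx H]; split=> // r r0; case: (H r r0) => [|rm]; first by left.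
have [|rp] := leP p.+1%:R^-1 (2 * r); [by left|right].
apply: le_trans rm; apply: ger_powR => //.
rewrite mulr_gt0//= (le_trans (ltW rp))// invf_le1// ler1n//.
Qed.

(** [Xbar] involves ln r and [Xlevel] involves 2 r: the gap between the intermediate exponent [eta']
    and [eta] absorbs the factor 2^eta for small r. *)
Lemma Xbar_Xlevel eta x : alpha < eta -> Xbar mu alpha x ->
  exists p, Xlevel mu alpha eta p.+1 x.
Proof.
move=> ae Xx; case: (Xx) => suppx lex.
pose eta' := (alpha + eta) / 2.
have ae' : alpha < eta' by rewrite /eta'; exact: (midf_lt ae).1.
have ee' : eta' < eta by exact: (midf_lt ae).2.
have /ereal_inf_lt[_ [V FV <-] Vle] : (limf_esup
    (fun r : R => (ln (mball mu x r) / ln r)%:E) (0^'+) < eta'%:E)%E.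
  by apply: le_lt_trans lex _; rewrite lte_fin.
have : (0^'+)%classic [set r : R | [/\ V r, r < 1 & 2 `^ eta * r `^ (eta - eta') < 1]].
  near=> r; split => //.
  - by near: r.
  - near: r; apply: (cvgr_lt (2 `^ eta * 0)); last by rewrite mulr0.
    by apply: cvgMl_tmp; apply: powR_cvg0; rewrite subr_gt0.
move=> /at_right0P[e e0 He].
have [p pe] := filter_ex (near_infty_natSinv_lt (PosNum e0)).
exists p; split=> // r r0.
have [|rp] := leP p.+1%:R^-1 (2 * r); [by left|right].
have re : r < e.
  apply: (lt_trans _ pe); apply: lt_trans rp.
  by rewrite ltr_pMl// ltr1n.
have [|Vr r1 rle] := He r; first by rewrite r0.
have rm : r `^ eta' <= mball mu x r.
  rewrite -ln_ratio_le ?r0//; last exact: mball_gt0.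
  rewrite -lee_fin (le_trans _ (ltW Vle))//.
  by apply: ereal_sup_ubound; exists r.
apply: le_trans rm.
have -> : (2 * r) `^ eta = 2 `^ eta * r `^ (eta - eta') * r `^ eta'.
  by rewrite powRM ?(ltW r0)// -mulrA -powRD ?subrK// (gt_eqF r0) implybT.
by rewrite ler_piMl ?powR_ge0// ltW.
Unshelve. all: by end_near. Qed.

Lemma Tmu_p_nondecreasing eta :
  {homo (fun p => Tmu_p mu u alpha eta p.+1) : n m / (n <= m)%N >-> (n <= m)%E}.
Proof.
move=> p p' pp'; apply: ge_ereal_sup => _ [M MX <-].
by apply: ereal_sup_ubound; exists M => //=; apply: subset_trans MX (Xlevel_le_p pp').
Qed.

(* Xlevel at p = 0 is all of Xbar, so Tmu_p is monotone from p = 1 on only. *)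
Lemma Tmu_etaE eta :
  Tmu_eta mu u alpha eta = ereal_sup (range (fun p => Tmu_p mu u alpha eta p.+1)).
Proof.
apply: cvg_lim => //; rewrite -cvg_shiftS.
exact/ereal_nondecreasing_cvgn/Tmu_p_nondecreasing.
Qed.

Lemma L_le_Tmu_eta eta p M : M `<=` Xlevel mu alpha eta p.+1 ->
  (L mu u M <= Tmu_eta mu u alpha eta)%E.
Proof.
move=> MX; rewrite Tmu_etaE; apply: (@le_trans _ _ (Tmu_p mu u alpha eta p.+1)).
  by apply: ereal_sup_ubound; exists M.
by apply: ereal_sup_ubound; exists p.
Qed.

Lemma Tmu_eta_nondecreasing eta eta' : eta <= eta' ->
  (Tmu_eta mu u alpha eta <= Tmu_eta mu u alpha eta')%E.
Proof.
move=> ee'; rewrite Tmu_etaE; apply: ge_ereal_sup => _ [p _ <-].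
apply: ge_ereal_sup => _ [M MX <-]; apply: (@L_le_Tmu_eta _ p).
exact: subset_trans MX (Xlevel_le_eta ee').
Qed.

Lemma Tmu_cvg : Tmu_eta mu u alpha eta @[eta --> alpha^'+] --> Tmu mu u alpha.
Proof.
apply: nondecreasing_at_right_is_cvge.
by near=> e => a b _ _; exact: Tmu_eta_nondecreasing.
Unshelve. all: by end_near. Qed.

Hypothesis hu : forall eps : R, 0 < eps -> eps <= u eps.

(** Masses are at most 1 and 2 r < 1, so every quotient is nonnegative; a one-ball packing keeps the
    supremum from being over an empty family, where it is -oo. *)
Lemma L_ge0 M : M `<=` supp mu -> M !=set0 -> (0 <= L mu u M)%E.
Proof.
move=> Ms [x Mx]; apply: lime_ge.
  exact/ereal_nonincreasing_is_cvgn/Lk_nonincreasing.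
near=> k; apply: limf_einf_ge_near.
near=> e.
have e0 : 0 < e by [].
have e1 : e < 1 by near: e; exact: nbhs_right_lt.
apply: (@le_trans _ _ (Lk_packing mu u k e M [set 0%N] (fun=> e / 2))); last first.
  apply: ereal_sup_ubound; exists [set 0%N], (fun=> x), (fun=> e / 2);
  by split => //; exact: packing_single.
apply: le_ereal_inf_tmp => _ [y [s [[m [c [_ [cm Mys]]]] ->]]].
have [My /andP[s0 _]] := (Mys _ (cm 0%N erefl)).1 0%N (conj erefl erefl).
apply: le_trans (ereal_sup_ubound _); last by exists 0%N.
rewrite lee_fin ln_ratio_ge0//.
  by rewrite mulrCA divff// mulr1 e0.
by rewrite mball_le1 mball_gt0//; exact: Ms.
Unshelve. all: by end_near. Qed.

(** Each packing is matched with itself, as a single part; [eps <= u eps] permits this. Small radii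
    lie below the threshold of [Xlevel], which bounds the quotients. *)
Lemma L_le_eta eta p M : M `<=` Xlevel mu alpha eta p.+1 ->
  (L mu u M <= eta%:E)%E.
Proof.
move=> MX; apply: lime_le.
  exact/ereal_nonincreasing_is_cvgn/Lk_nonincreasing.
near=> k; apply: limf_einf_le_near.
near=> e.
have ep : 2 * e < p.+1%:R^-1.
  by rewrite -ltr_pdivlMl//; near: e; apply: nbhs_right_lt; rewrite mulr_gt0 ?invr_gt0.
apply: ge_ereal_sup => _ [I [x [r [Mxr ->]]]].
apply: (@le_trans _ _ (ereal_sup
    [set (ln (mball mu (x i) (r i)) / ln (2 * r i))%:E | i in I])).
  apply: ereal_inf_lbound; exists x, r; split => //.
  exists 1%N, (fun=> 0%N); split; first by near: k; exact: nbhs_infty_ge.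
  split=> // -[_|//]; apply: packing_le (hu _) _ => //.
  by rewrite (_ : [set i | _] = setT) ?setIT//; apply/seteqP; split.
apply: ge_ereal_sup => _ [i Ii <-].
have [Mx /andP[r0 re]] := Mxr.1 i Ii.
have [[suppx _] Xx] := MX _ Mx.
have rp : 2 * r i < p.+1%:R^-1 by apply: lt_trans ep; rewrite ltr_pM2l.
rewrite lee_fin ln_ratio_le//.
- by case: (Xx _ r0) => //; rewrite leNgt rp.
- by rewrite mulr_gt0//= (lt_le_trans rp)// invf_le1// ler1n.
- exact: mball_gt0.
Unshelve. all: by end_near. Qed.

(** Makes [Tmu] finite and, in the theorem, keeps the factor T / alpha at most 1. *)
Lemma Tmu_le : (Tmu mu u alpha <= alpha%:E)%E.
Proof.
apply/lee_addgt0Pr => e e0; apply: lime_le; first by apply: cvgP; exact: Tmu_cvg.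
near=> eta; rewrite Tmu_etaE; apply: ge_ereal_sup => _ [p _ <-].
apply: ge_ereal_sup => _ [M MX <-]; apply: (le_trans (L_le_eta MX)).
rewrite lee_fin; near: eta; apply: nbhs_right_ltW.
by rewrite ltrDl.
Unshelve. all: by end_near. Qed.

Lemma Tmu_ge0 : Xbar mu alpha !=set0 -> (0 <= Tmu mu u alpha)%E.
Proof.
move=> [x Xx]; apply: lime_ge; first by apply: cvgP; exact: Tmu_cvg.
near=> eta.
have [|p Xp] := @Xbar_Xlevel eta x _ Xx; first by [].
apply: le_trans (@L_le_Tmu_eta eta p [set x] _); last by move=> _ ->.
by apply: L_ge0; [move=> _ ->; case: Xx|exists x].
Unshelve. all: by end_near. Qed.

(** * Countable covers and the dimension of the level set *)

Hypothesis hu0 : u eps @[eps --> 0^'+] --> (0 : R).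

Lemma Dim_Xbar_le (F : nat -> set 'rV[R]_d) q tau eta l t :
  0 < alpha < eta -> tau <= 0 -> 0 <= q + tau / eta ->
  supp mu `<=` \bigcup_n F n -> (forall n, Pbar mu q tau (F n) < +oo)%E ->
  (Tmu_eta mu u alpha eta < l%:E)%E -> l * (q + tau / eta) < t ->
  (Dim mu (Xbar mu alpha) <= t%:E)%E.
Proof.
move=> /andP[a0 ae] tau0 k0 sF PF Tl lt.
apply: ereal_inf_lbound; exists t => //=.
(* [n] codes a pair (i, p): [F i] supplies the finite premeasure, [Xlevel] the bound on [L]. An [n]
   coding no pair gets (0, 0), which only repeats a piece. *)
pose G n := let ip := odflt (0, 0)%N (unpickle n) in
  F ip.1 `&` Xlevel mu alpha eta ip.2.+1.
apply/eqP; rewrite eq_le; apply/andP; split; last first.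
  apply: le_ereal_inf_tmp => _ [? _ <-].
  by apply: nneseries_ge0 => i _ _; exact: Pbar_ge0.
apply: ereal_inf_lbound; exists G.
  move=> x Xx; have [p Xp] := Xbar_Xlevel ae Xx.
  have [i _ Fi] := sF _ Xx.1.
  by exists (pickle (i, p)) => //; rewrite /G pickleK.
apply: eseries0 => n _ _; apply: (Pbar_exponent lt).
apply: (@Pbar_change_exponent _ _ _ u hu0 _ _ _ _ alpha
  (odflt (0, 0)%N (unpickle n)).2) => //.
- exact: lt_trans ae.
- exact: subIsetr.
- by apply: le_lt_trans (PF (odflt (0, 0)%N (unpickle n)).1);
  apply: Pbar_sub; exact: subIsetl.
- by apply: le_lt_trans Tl; apply: L_le_Tmu_eta; exact: subIsetr.
Qed.

Lemma Pmu_eq0_cover q tau : Pmu mu q tau (supp mu) = 0%E ->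
  exists2 F : nat -> set 'rV[R]_d, supp mu `<=` \bigcup_n F n &
    (forall n, Pbar mu q tau (F n) < +oo)%E.
Proof.
move=> P0.
have /ereal_inf_lt[_ [F sF <-] Foo] : (Pmu mu q tau (supp mu) < +oo)%E.
  by rewrite P0.
exists F => // n; apply: le_lt_trans Foo; rewrite (@nneseriesD1 _ _ n)//; last first.
  by move=> k _; exact: Pbar_ge0.
by rewrite leeDl// nneseries_ge0// => k _ _; exact: Pbar_ge0.
Qed.

(* A single small ball centered at a point of the level set contributes at least
   (2 r)^(q eta + tau) to the packing sums, which would be unbounded. *)
Lemma Xbar_eq0 q : 0 <= q -> (Bmu mu q < (- (alpha * q))%:E)%E ->
  Xbar mu alpha = set0.
Proof.
move=> q0 /ereal_inf_lt[_ [tau /= Ptau <-]]; rewrite lte_fin => taulb.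
have [F sF PF] := Pmu_eq0_cover Ptau.
have aqt : alpha * q + tau < 0 by rewrite addrC -ltrBrDr sub0r.
apply/seteqP; split=> // x Xx.
have [eta [ae eqt]] : exists eta, alpha < eta /\ eta * q + tau < 0.
  near alpha^'+ => eta; exists eta; split; first by [].
  near: eta; apply: (cvgr_lt (alpha * q + tau)) => //.
  by apply: cvg_at_right_filter; apply: cvgD; [apply: cvgMr_tmp|apply: cvg_cst].
have [p [_ Xp]] := Xbar_Xlevel ae Xx.
have [n _ Fn] := sF _ Xx.1.
(* Above [tau] the premeasure vanishes, yet at exponent -(eta q) a ball of diameter e contributes
   mu^q / e^(eta q) >= 1. *)
have tqe : tau < - (eta * q) by rewrite -subr_lt0 opprK addrC.
have := Pbar_exponent tqe (PF n).
suff : (1 <= Pbar mu q (- (eta * q)) (F n))%E by move=> /[swap] ->; rewrite lee_fin ler10.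
apply: lime_ge; first by apply: cvgP; exact: Pbar_cvg.
near=> e.
have e0 : 0 < e by [].
have ep : e < p.+1%:R^-1 by near: e; apply: nbhs_right_lt; rewrite invr_gt0.
apply: (@le_trans _ _ (packing_sum mu q (- (eta * q)) [set 0%N]
  (fun=> x) (fun=> e / 2))); last first.
  apply: ereal_sup_ubound; exists [set 0%N], (fun=> x), (fun=> e / 2);
  by split => //; exact: packing_single.
rewrite /packing_sum esum_set1 ?term_ge0// /mpow ltNge q0 andbF -EFinM lee_fin.
rewrite mulrCA divff// mulr1 powRN powRrM ler_pdivlMr ?mul1r ?powR_gt0//.
rewrite ge0_ler_powR// ?nnegrE ?powR_ge0 ?mball_ge0//.
have [|pe|] := Xp (e / 2); first by rewrite divr_gt0.
  by move: pe; rewrite mulrCA divff// mulr1 leNgt ep.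
by rewrite mulrCA divff// mulr1.
Unshelve. all: by end_near. Qed.

(** Lets [eta] decrease to [alpha] and [l] to T in [Dim_Xbar_le]; as tau <= 0, q + tau / eta stays
    nonnegative for eta > alpha. *)
Lemma Dim_Xbar_Tmu (F : nat -> set 'rV[R]_d) q tau :
  0 < alpha -> tau <= 0 -> 0 <= q + tau / alpha ->
  supp mu `<=` \bigcup_n F n -> (forall n, Pbar mu q tau (F n) < +oo)%E ->
  Tmu mu u alpha \is a fin_num ->
  (Dim mu (Xbar mu alpha) <= (fine (Tmu mu u alpha) * (q + tau / alpha))%:E)%E.
Proof.
move=> a0 tau0; set c := q + tau / alpha => c0 sF PF Tfin.
set T := fine _; apply/lee_addgt0Pr => e e0.
have c1 : 0 < c + 1 by rewrite ltr_wpDl.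
(* The denominator c + 1 allows c = 0 and still gives l c < T c + e. *)
pose l := T + e / (c + 1).
have Tl : (Tmu mu u alpha < l%:E)%E.
  by rewrite -(fineK Tfin) lte_fin ltrDl divr_gt0.
have lc : l * c < T * c + e.
  rewrite mulrDl ltrD2l mulrAC ltr_pdivrMr// ltr_pM2l//.
  by rewrite ltrDl.
near alpha^'+ => eta.
have ae : alpha < eta by [].
apply: (@Dim_Xbar_le F q tau eta l) => //.
- by rewrite a0 ae.
- apply: (le_trans c0); rewrite lerD2l ler_wnM2l// lef_pV2 ?posrE//.
  exact: lt_trans ae.
- near: eta; apply: (@Tmu_cvg [set y | (y < l%:E)%E]).
  exact: open_ereal_lt'.
- near: eta; apply: (cvgr_lt (l * c)) => //.
  apply: cvg_at_right_filter; apply: cvgMl_tmp; apply: cvgD; first exact: cvg_cst.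
  by apply: cvgMl_tmp; apply: cvgV => //; rewrite gt_eqF.
Unshelve. all: by end_near. Qed.

End LevelSets.

(** * The empty level set and the final estimate *)

Lemma Dim_set0 (R : realType) (d : nat) (mu : probability (borelRd R d) R) :
  Dim mu set0 = -oo%E.
Proof.
apply: eq_ninfty => t; apply: ereal_inf_lbound; exists t => //=.
apply/eqP; rewrite eq_le; apply/andP; split; last first.
  apply: le_ereal_inf_tmp => _ [? _ <-].
  by apply: nneseries_ge0 => i _ _; exact: Pbar_ge0.
apply: ereal_inf_lbound; exists (fun=> set0) => //.
apply: eseries0 => n _ _; apply/eqP; rewrite eq_le Pbar_ge0 andbT.
apply: (le_trans (Pbar_le_Pbar_eps _ _ _ _ ltr01)).
apply: ge_ereal_sup => _ [I [x [r [[H _] ->]]]].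
rewrite (_ : I = set0) ?/packing_sum ?esum_set0//.
by apply/seteqP; split=> // i /H[].
Qed.

Theorem theorem2p2 (R : realType) (d : nat)
  (mu : probability (borelRd R d) R) (alpha : R) (u : R -> R)
  (halpha : 0 < alpha)
  (hu : forall eps : R, 0 < eps -> eps <= u eps)
  (hu0 : u eps @[eps --> 0^'+] --> (0 : R))
  (hs : (ereal_inf [set Bmu mu q | q in [set: R]] < 0)%E) :
  (Dim mu (Xbar mu alpha) <=
     (alpha^-1)%:E * Tmu mu u alpha *
     ereal_inf [set (alpha * q)%:E + Bmu mu q | q in [set q : R | (1 <= q)%R]])%E.
Proof.
have [->|/set0P Xn0] := eqVneq (Xbar mu alpha) set0; first by rewrite Dim_set0 leNye.
have T0 := Tmu_ge0 u Xn0; have Ta := Tmu_le mu alpha hu.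
have Tfin : Tmu mu u alpha \is a fin_num.
  by rewrite ge0_fin_numE// (le_lt_trans Ta)// ltry.
have bound F q tau := @Dim_Xbar_Tmu R d mu u alpha hu0 F q tau halpha.
rewrite -(fineK Tfin) in T0 Ta *; set T := fine _ in T0 Ta bound *.
set c := ereal_inf _.
(* This sign will make e' / alpha a nonnegative exponent. *)
have c0 : (0 <= c)%E.
  rewrite leNgt; apply/negP => /ereal_inf_lt[_ [q /= q1 <-]] Bq.
  have [x] := Xn0; rewrite (@Xbar_eq0 _ _ _ alpha q)//; first exact: le_trans q1.
  by rewrite EFinN -sub0e lteBrDl.
have [ac|ca] := leP alpha%:E c.
  (* This case includes [c = +oo]. Exponents (1, 0) with the constant cover [setT] give Dim <= T,
     and T <= T c / alpha because T >= 0. *)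
  apply: (@le_trans _ _ T%:E).
    have := bound (fun=> setT) 1 0; rewrite mul0r addr0 mulr1; apply => //.
    - by exists 0%N.
    - by move=> _; rewrite (le_lt_trans (Pbar_le_Pbar_eps _ _ _ _ ltr01))//
        (le_lt_trans (Pbar_eps_1_0 _ _ _))// ltry.
  apply: (@le_trans _ _ ((alpha^-1)%:E * T%:E * alpha%:E)%E).
    by rewrite -!EFinM lee_fin mulrAC mulVf ?mul1r// gt_eqF.
  by rewrite lee_wpmul2l// -EFinM lee_fin mulr_ge0// invr_ge0 ltW.
have cfin : c \is a fin_num by rewrite ge0_fin_numE// (lt_trans ca)// ltry.
rewrite -(fineK cfin) in c0 ca *.
rewrite -!EFinM; apply/lee_addgt0Pr => e e0; rewrite -EFinD.
(* With tau = e' - alpha q, the choice of q gives tau > Bmu q, and q >= 1 gives tau <= e' - alpha <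
   0; then q + tau / alpha = e' / alpha. *)
near (fine c)^'+ => e'.
have ce' : fine c < e' by [].
have e'a : e' < alpha by near: e'; exact: nbhs_right_lt.
have [_ [q /= q1 <-] Bq] : exists2 y, [set (alpha * q)%:E + Bmu mu q
    | q in [set q : R | (1 <= q)%R]]%E y & (y < e'%:E)%E.
  by apply: ereal_inf_lt; rewrite -/c -(fineK cfin) lte_fin.
have aq : alpha <= alpha * q by rewrite ler_peMr// ltW.
have qE : q + (e' - alpha * q) / alpha = e' / alpha.
  by rewrite mulrBl [alpha * q]mulrC mulfK ?gt_eqF// addrC subrK.
have e'0 : 0 <= e' by apply: le_trans (ltW ce'); rewrite -lee_fin.
have [|F sF PF] := Pmu_eq0_cover
    ((Dimq_critical mu q (supp mu)).2 (e' - alpha * q) _).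
  by rewrite EFinB lteBrDl.
apply: (le_trans (bound F q (e' - alpha * q) _ _ sF PF Tfin)).
- by rewrite subr_le0 (le_trans (ltW e'a)).
- by rewrite qE divr_ge0// ltW.
rewrite qE lee_fin.
(* The excess over the target is T / alpha (e' - c), at most e' - c since T <= alpha. *)
have -> : T * (e' / alpha) = alpha^-1 * T * fine c + T / alpha * (e' - fine c).
  by field; rewrite gt_eqF.
rewrite lerD2l (@le_trans _ _ (1 * (e' - fine c)))//.
  by rewrite ler_wpM2r ?subr_ge0 ?(ltW ce')// ler_pdivrMr// mul1r -lee_fin.
rewrite mul1r lerBlDl; near: e'; apply: nbhs_right_ltW.
by rewrite ltrDl.
Unshelve. all: by end_near. Qed.
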